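(* Let $\mathcal H$ be a real Hilbert space, $\mu\ge 0$, $t_0>0$, and let $\Phi:\mathcal H\to\mathbb R$ be continuously Fréchet differentiable and $\mu$-strongly convex with $\operatorname{argmin}\Phi\neq\varnothing$. Let $\theta:[t_0,+\infty)\to(0,+\infty)$ be continuously differentiable and nondecreasing with $$0<2\dot\theta(t)+\mu\theta(t)^2\le 1\qquad\text{for all }t\ge t_0.$$ Let $x\in C^2([t_0,+\infty),\mathcal H)$ be a global solution of $$\ddot x(t)+\left(\frac{1+\dot\theta(t)}{\theta(t)}+\mu\theta(t)\right)\dot x(t)+\nabla\Phi(x(t))=0,\qquad t\ge t_0,$$ let $x^*\in\operatorname{argmin}\Phi$, and $\Phi^*=\Phi(x^* )$. Then, for every $t\ge t_0$, $$\Phi(x(t))-\Phi^*\le\frac{\mathcal E(t_0)}{A(t)},$$ where $$A(t)=\theta(t)^2\exp\left(\int_{t_0}^t\mu\theta(s)\,ds\right),$$ $$\mathcal E(t)=A(t)\bigl(\Phi(x(t))-\Phi^*\bigr)+\frac{A(t)}{2\theta(t)^2}\left\|x(t)-x^*+\theta(t)\dot x(t)\right\|^2 .$$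
   Context: A differentiable function $\Phi$ on $\mathcal H$ is $\mu$-strongly convex ($\mu\ge0$; for $\mu=0$ this is convexity) if $\Phi(y)\ge\Phi(x)+\langle\nabla\Phi(x),y-x\rangle+\frac{\mu}{2}\|y-x\|^2$ for all $x,y\in\mathcal H$. *)

(* Defs.v *)
From mathcomp Require Import all_boot all_order all_algebra.
From mathcomp Require Import sesquilinear.
From mathcomp Require Import all_classical all_reals all_analysis.

Set Implicit Arguments.
Unset Strict Implicit.
Unset Printing Implicit Defensive.

Import Order.TTheory GRing.Theory Num.Theory.
Import numFieldNormedType.Exports.

Local Open Scope classical_set_scope.
Local Open Scope ring_scope.

(* A real Hilbert space is a complete normed module [H] over [R : realType]
   together with [dot : {dot H for idfun}] (a symmetric bilinear positive
   definite form) such that [norm_from_dot dot]. *)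
Definition norm_from_dot (R : realType) (H : normedModType R)
    (dot : {dot H for idfun}) : Prop :=
  forall u : H, `|u| ^+ 2 = dot u u.

(* The second conjunct is continuity of the derivative for the operator norm
   of the dual space. *)
Definition continuously_frechet_differentiable (R : realType)
    (H : normedModType R) (Phi : H -> R) : Prop :=
  (forall x : H, differentiable Phi x) /\
  (forall (x : H) (e : R), 0 < e ->
     \forall y \near x, forall v : H,
       `|'d Phi y v - 'd Phi x v| <= e * `|v|).

(* For [Phi] differentiable at [x], the Riesz representative of its
   differential; it is unique, and exists because [H] is complete. *)
Definition gradient (R : realType) (H : normedModType R)
    (dot : {dot H for idfun}) (Phi : H -> R) (x : H) : H :=
  get [set g : H | forall v : H, 'd Phi x v = dot g v].

Definition strongly_convex (R : realType) (H : normedModType R)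
    (dot : {dot H for idfun}) (mu : R) (Phi : H -> R) : Prop :=
  forall x y : H,
    Phi x + dot (gradient dot Phi x) (y - x) + mu / 2 * `|y - x| ^+ 2 <= Phi y.

Definition argmin (R : realType) (T : Type) (Phi : T -> R) : set T :=
  [set z | forall y, Phi z <= Phi y].

(* Functions on a subset [D] of [R] are total functions of which only the
   values on [D] matter. The derivative relative to [D] is the limit of the
   difference quotient at [t] along [s] in [D], [s != t]: it is one-sided at an
   endpoint of the interval [D], and the usual derivative in its interior. *)
Definition quotient_on (R : realType) (V : normedModType R) (D : set R)
    (f : R -> V) (t : R) : set_system V :=
  (s - t)^-1 *: (f s - f t) @[s --> within D t^'].

Definition derivable_on (R : realType) (V : normedModType R) (D : set R)
    (f : R -> V) : Prop :=
  forall t : R, D t -> cvg (quotient_on D f t).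

Definition derive_on (R : realType) (V : normedModType R) (D : set R)
    (f : R -> V) (t : R) : V :=
  lim (quotient_on D f t).

Definition C1_on (R : realType) (V : normedModType R) (D : set R)
    (f : R -> V) : Prop :=
  derivable_on D f /\ {within D, continuous (derive_on D f)}.

Definition C2_on (R : realType) (V : normedModType R) (D : set R)
    (f : R -> V) : Prop :=
  derivable_on D f /\ C1_on D (derive_on D f).

Definition scaling (R : realType) (mu t0 : R) (theta : R -> R) (t : R) : R :=
  theta t ^+ 2 *
  expR (\int[lebesgue_measure]_(s in `[t0, t]) (mu * theta s)).

Definition energy (R : realType) (H : normedModType R) (mu t0 : R)
    (theta : R -> R) (Phi : H -> R) (x : R -> H) (xstar : H) (t : R) : R :=
  scaling mu t0 theta t * (Phi (x t) - Phi xstar) +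
  scaling mu t0 theta t / (2 * theta t ^+ 2) *
    `|x t - xstar + theta t *: derive_on `[t0, +oo[ x t| ^+ 2.

(* Main.v *)
Require Import Defs.
From mathcomp Require Import all_boot all_order all_algebra.
From mathcomp Require Import sesquilinear.
From mathcomp Require Import all_classical all_reals all_analysis.
From mathcomp Require Import ring lra.

Set Implicit Arguments.
Unset Strict Implicit.
Unset Printing Implicit Defensive.

Import Order.TTheory GRing.Theory Num.Theory.
Import numFieldNormedType.Exports.

Local Open Scope classical_set_scope.
Local Open Scope ring_scope.

(** With K(t) the exponential of the integral of mu * theta, so that
    A = theta^2 K, the energy is
      E = K (theta^2 (Phi(x) - Phi* ) + |z|^2 / 2),  z = x - x* + theta x'.
    The weights are tuned so that the ODE gives
      z' = - mu theta^2 x' - theta grad Phi(x):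
    the damping coefficient cancels both x' and theta' x'.  In E' the power
    <grad Phi(x), x'> of the gradient along the trajectory then cancels, and
    completing the square in mu theta |z|^2 / 2 - mu theta^2 <z, x'> leaves
      E' / K = theta (2 theta' + mu theta^2) (Phi(x) - Phi* )
               - theta <x - x*, grad Phi(x)>
               + mu theta / 2 (|x - x*|^2 - theta^2 |x'|^2).
    Strong convexity between x and x* bounds <x - x*, grad Phi(x)> from below
    by Phi(x) - Phi* + mu / 2 |x - x*|^2, hence
      E' / K <= theta (2 theta' + mu theta^2 - 1) (Phi(x) - Phi* )
                - mu theta^3 / 2 |x'|^2 <= 0
    ([inertial_dissipation]).  So E is nonincreasing and
    A(t) (Phi(x(t)) - Phi* ) <= E(t) <= E(t0).

    Monotonicity on [t0, t] follows from the sign of E' in the open interval,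
    where derivatives relative to [t0, +oo[ are the usual ones
    ([is_derive_lyapunov]), and from continuity of E up to the endpoints
    ([lyapunov_continuous]). *)

(** * The inner product and its calculus *)

Lemma dotC (R : realType) (H : normedModType R) (dot : {dot H for idfun})
  (u v : H) : dot u v = dot v u.
Proof. by rewrite hermC expr0 mul1r. Qed.

Lemma dotDl (R : realType) (H : normedModType R) (dot : {dot H for idfun})
  (u v w : H) : dot (u + v) w = dot u w + dot v w.
Proof. exact: linearDl. Qed.

Lemma dotZl (R : realType) (H : normedModType R) (dot : {dot H for idfun})
  (c : R) (u w : H) : dot (c *: u) w = c * dot u w.
Proof. exact: linearZl_LR. Qed.

Lemma dotDr (R : realType) (H : normedModType R) (dot : {dot H for idfun})
  (u v w : H) : dot w (u + v) = dot w u + dot w v.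
Proof. exact: linearDr. Qed.

Lemma dotZr (R : realType) (H : normedModType R) (dot : {dot H for idfun})
  (c : R) (u w : H) : dot w (c *: u) = c * dot w u.
Proof. exact: linearZr_LR. Qed.

Lemma dot_polarization (R : realType) (H : normedModType R)
    (dot : {dot H for idfun}) (hdot : norm_from_dot dot) (u v : H) :
  dot u v = (`|u + v| ^+ 2 - `|u| ^+ 2 - `|v| ^+ 2) / 2.
Proof. by rewrite !hdot hnormD expr0 mul1r /=; field. Qed.

(** The inner product is a polynomial in norms, so its joint continuity is that
    of the norm. *)
Lemma cvg_dot (R : realType) (H : normedModType R) (dot : {dot H for idfun})
    (hdot : norm_from_dot dot) (T : Type) (F : set_system T) (FF : Filter F)
    (f g : T -> H) (a b : H) :
  f @ F --> a -> g @ F --> b -> (fun s => dot (f s) (g s)) @ F --> dot a b.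
Proof.
move=> fa gb.
under eq_fun do rewrite (dot_polarization hdot).
rewrite (dot_polarization hdot) ![_ ^+ 2]expr2.
under eq_fun do rewrite !expr2.
apply: cvgM; last exact: cvg_cst.
have sq (h : T -> H) c : h @ F --> c ->
    `|h s| * `|h s| @[s --> F] --> `|c| * `|c|.
  by move=> hc; apply: cvgM; exact: cvg_norm.
by apply: cvgB; [apply: cvgB|]; apply: sq => //; exact: cvgD.
Qed.

(** |z(t+h)|^2 - |z(t)|^2 = <z(t+h) - z(t), z(t+h) + z(t)>: the difference
    quotient is an inner product whose two arguments both converge. *)
Lemma is_derive_normsq (R : realType) (H : normedModType R)
    (dot : {dot H for idfun}) (hdot : norm_from_dot dot)
    (z : R -> H) (t : R) (dz : H) :
  is_derive t 1 z dz ->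
  is_derive t 1 (fun s => `|z s| ^+ 2) (2 * dot (z t) dz).
Proof.
move=> [zd <-].
suff q : (fun h : R => h^-1 *: (((fun s => `|z s| ^+ 2) \o shift t) (h *: 1)
    - `|z t| ^+ 2)) @ 0^' --> 2 * dot (z t) ('D_1 z t).
  by split; [apply/cvg_ex; eexists; exact: q|exact: cvg_lim q].
have -> : 2 * dot (z t) ('D_1 z t) = dot ('D_1 z t) (z t + z t).
  by rewrite linearDr dotC /=; ring.
under eq_fun => h.
  rewrite /= (_ : h^-1 *: _ = dot (h^-1 *: (z (h *: 1 + t) - z t))
    (z (h *: 1 + t) + z t)); last first.
    rewrite !hdot linearZl_LR linearBl !linearDr /=.
    by rewrite (dotC dot (z t) (z (_ + t))) -[LHS]/(_ * _); ring.
  over.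
apply: cvg_dot => //; apply: cvgD; last exact: cvg_cst.
suff : {for 0, continuous (fun h : R => z (h *: 1 + t))}.
  by move=> /continuous_withinNx; rewrite scale0r add0r.
exact/differentiable_continuous/derivable1_diffP/(derivable1P _ _ _).1.
Qed.

Lemma is_derive_scale (R : realType) (H : normedModType R)
    (a : R -> R) (y : R -> H) (t da : R) (dy : H) :
  is_derive t 1 a da -> is_derive t 1 y dy ->
  is_derive t 1 (fun s => a s *: y s) (da *: y t + a t *: dy).
Proof.
move=> [ad <-] [yd <-].
suff q : (fun h : R => h^-1 *: (((fun s => a s *: y s) \o shift t) (h *: 1)
    - a t *: y t)) @ 0^' --> 'D_1 a t *: y t + a t *: 'D_1 y t.
  by split; [apply/cvg_ex; eexists; exact: q|exact: cvg_lim q].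
under eq_fun => h.
  rewrite /= (_ : h^-1 *: _ = (h^-1 *: (a (h *: 1 + t) - a t)) *: y t +
    a (h *: 1 + t) *: (h^-1 *: (y (h *: 1 + t) - y t))); last first.
    rewrite [in RHS]scalerA [_ * h^-1]mulrC -!scalerA -scalerDr.
    by congr (_ *: _); rewrite scalerBl scalerBr [RHS]addrC addrA subrK.
  over.
apply: cvgD; first by apply: cvgZ => //; exact: cvg_cst.
apply: cvgZ => //.
suff : {for 0, continuous (fun h : R => a (h *: 1 + t))}.
  by move=> /continuous_withinNx; rewrite scale0r add0r.
exact/differentiable_continuous/derivable1_diffP/(derivable1P _ _ _).1.
Qed.

(** * Gradient and differential *)

(** The existence of the Riesz representative comes from strong convexity
    itself.  Along a ray u + h w, with h > 0, the inequality says that the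
    difference quotient is at least <g, w>, g being the gradient at u, so the
    linear form 'd Phi u dominates <g, _>; comparing at w and - w, the two
    forms are equal. *)
Lemma strongly_convex_gradient (R : realType) (H : normedModType R)
    (dot : {dot H for idfun}) (mu : R) (Phi : H -> R) (u v : H) :
  0 <= mu -> strongly_convex dot mu Phi -> differentiable Phi u ->
  'd Phi u v = dot (gradient dot Phi u) v.
Proof.
move=> mu0 sc du; set g := gradient _ _ _.
suff le w : dot g w <= 'd Phi u w.
  apply/eqP; rewrite eq_le le andbT.
  by rewrite -lerN2; have := le (- v); rewrite linearNr linearN.
rewrite -deriveE //.
have /cvg_dnbhs_at_right lim :
    (fun h => h^-1 *: ((Phi \o shift u) (h *: w) - Phi u)) @ 0^'
    --> 'D_w Phi u by exact: diff_derivable.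
apply: (cvgr_to_ge lim); near=> h.
have h0 : 0 < h by near: h; exact: nbhs_right_gt.
rewrite /= -[_ *: _]/(_ * _) ler_pdivlMl // -[h * _](linearZr_LR dot) lerBrDl.
apply: le_trans (sc u (h *: w + u)).
by rewrite addrK lerDl mulr_ge0 // ?divr_ge0 // sqr_ge0.
Unshelve. all: by end_near. Qed.

Lemma is_derive_comp_differential (R : realType) (H : normedModType R)
    (Phi : H -> R) (x : R -> H) (t : R) (dx : H) :
  differentiable Phi (x t) -> is_derive t 1 x dx ->
  is_derive t 1 (Phi \o x) ('d Phi (x t) dx).
Proof.
move=> dPhi [xd <-].
have xd' : differentiable x t by exact/derivable1_diffP.
have dc : differentiable (Phi \o x) t by exact: differentiable_comp.
split; first exact/derivable1_diffP.
by rewrite (deriveE _ dc) (diff_comp xd' dPhi) /= (deriveE _ xd').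
Qed.

(** * Derivatives relative to a set *)

Lemma is_derive_derive_on (R : realType) (V : normedModType R) (D : set R)
    (f : R -> V) (t : R) :
  nbhs t D -> derivable_on D f -> is_derive t 1 f (derive_on D f t).
Proof.
move=> tD fD.
suff q : (fun h : R => h^-1 *: ((f \o shift t) (h *: 1) - f t)) @ 0^'
    --> derive_on D f t.
  by split; [apply/cvg_ex; eexists; exact: q|exact: cvg_lim q].
have /fD c : D t := nbhs_singleton tD.
move=> A /c cA.
have {cA} : \forall s \near t, s != t -> D s -> A ((s - t)^-1 *: (f s - f t)).
  exact: cA.
rewrite (near_shift 0) subr0 => cA.
suff : \forall h \near 0, h != 0 -> A (h^-1 *: (f (h *: 1 + t) - f t)) by [].
have tD' : \forall h \near 0, D (h + t).
  move: tD; rewrite -[nbhs t D]/(\forall s \near t, D s).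
  by rewrite (near_shift 0) subr0.
near=> h => h0.
have Dh : D (h + t) by near: h.
have : h + t != t -> D (h + t) -> A ((h + t - t)^-1 *: (f (h + t) - f t)).
  by near: h.
rewrite addrK [_ *: 1]mulr1; apply => //.
by rewrite -subr_eq0 addrK.
Unshelve. all: by end_near. Qed.

Lemma derivable_on_continuous (R : realType) (V : normedModType R) (D : set R)
    (f : R -> V) :
  derivable_on D f -> {within D, continuous f}.
Proof.
move=> fD; apply/subspace_continuousP => t Dt.
have c := fD t Dt.
have idt : s - t @[s --> within D t^'] --> t - t.
  apply: cvg_within_filter; apply: cvg_within_filter.
  by apply: cvgB; [exact: cvg_id|exact: cvg_cst].
have q : f s @[s --> within D t^'] --> f t.
  have q0 : (s - t) *: ((s - t)^-1 *: (f s - f t)) + f t @[s --> within D t^']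
      --> (t - t) *: derive_on D f t + f t.
    by apply: cvgD; [exact: cvgZ idt c|exact: cvg_cst].
  rewrite subrr scale0r add0r in q0; apply: cvg_trans q0; apply: near_eq_cvg.
  rewrite near_withinE near_withinE; apply: nearW => s st _.
  by rewrite scalerA mulfV ?subr_eq0 // scale1r subrK.
move=> A fA; have /= := q _ fA.
rewrite /nbhs /= /within /= => qA.
suff : \forall s \near t, D s -> A (f s) by [].
have {}qA : \forall s \near t, s != t -> D s -> A (f s) by exact: qA.
near=> s => Ds.
have [->|st] := eqVneq s t; first exact: nbhs_singleton.
by move: st Ds; near: s.
Unshelve. all: by end_near. Qed.

(** * The integral in the exponential weight *)

Lemma integral_continuous (R : realType) (a b : R) (f : R -> R) :
  a <= b -> {within `[a, b], continuous f} ->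
  {within `[a, b], continuous
    (fun s => \int[lebesgue_measure]_(r in `[a, s]) f r)}.
Proof.
move=> ab cf; apply: (parameterized_integral_continuous ab).
by apply: continuous_compact_integrable => //; exact: segment_compact.
Qed.

Lemma is_derive_integral (R : realType) (a b t : R) (f : R -> R) :
  a < t < b -> {within `[a, b], continuous f} ->
  is_derive t 1 (fun s => \int[lebesgue_measure]_(r in `[a, s]) f r) (f t).
Proof.
move=> /andP[at_ tb] cf.
have fi : lebesgue_measure.-integrable `[a, b] (EFin \o f).
  by apply: continuous_compact_integrable => //; exact: segment_compact.
have ft : {for t, continuous f}.
  apply: within_continuous_continuous cf _; first exact: lt_trans tb.
  by rewrite in_itv /= at_ tb.
have [d dE] := continuous_FTC1_closed tb fi at_ ft.
by split; [exact: d|rewrite -derive1E; exact: dE].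
Qed.

(** * The decreasing energy *)

(** The dissipation estimate, free of any time dependence: y, v, a, g stand for
    x - x*, x', x'' and the gradient at x, and P for the gap Phi(x) - Phi*.
    The left-hand side is E' / K; its opposite is a sum of three nonnegative
    terms, coming from the upper bound on 2 theta' + mu theta^2, from strong
    convexity, and from the kinetic energy. *)
Lemma inertial_dissipation (R : realType) (H : normedModType R)
    (dot : {dot H for idfun}) (hdot : norm_from_dot dot)
    (mu th dth P : R) (y v a g : H) :
  0 <= mu -> 0 < th -> 2 * dth + mu * th ^+ 2 <= 1 -> 0 <= P ->
  P + mu / 2 * `|y| ^+ 2 <= dot g y ->
  a + ((1 + dth) / th + mu * th) *: v + g = 0 ->
  mu * th * (th ^+ 2 * P + 2^-1 * `|y + th *: v| ^+ 2) +
  (2 * th * dth * P + th ^+ 2 * dot g v +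
   dot (y + th *: v) (v + (dth *: v + th *: a))) <= 0.
Proof.
move=> mu0 th0 bnd P0 sc ode.
have thn : th != 0 by rewrite gt_eqF.
(* The derivative of z, with the acceleration eliminated by the ODE. *)
have -> : v + (dth *: v + th *: a) = (- (mu * th ^+ 2)) *: v + (- th) *: g.
  have -> : a = (- ((1 + dth) / th + mu * th)) *: v - g.
    by rewrite scaleNr -opprD; apply/eqP; rewrite -addr_eq0 addrA ode.
  rewrite scalerBr scalerA (scaleNr th g) !addrA; congr (_ + _).
  rewrite -{1}[v]scale1r -!scalerDl; congr (_ *: _).
  by field.
rewrite hdot in sc; rewrite hdot.
rewrite !(dotDl, dotDr, dotZl, dotZr).
rewrite (dotC dot v y) (dotC dot y g) (dotC dot v g).
have vv : 0 <= dot v v by rewrite -hdot sqr_ge0.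
have h1 : 0 <= th * (1 - 2 * dth - mu * th ^+ 2) * P.
  by apply: mulr_ge0 => //; apply: mulr_ge0; lra.
have h2 : 0 <= th * (dot g y - P - mu / 2 * dot y y).
  by apply: mulr_ge0; lra.
have h3 : 0 <= mu * th ^+ 3 / 2 * dot v v.
  by rewrite mulr_ge0 // divr_ge0 // mulr_ge0 // exprn_ge0 // ltW.
rewrite -oppr_ge0; have := addr_ge0 (addr_ge0 h1 h2) h3.
by congr (0 <= _); field.
Qed.

(** The energy with A / theta^2 simplified to K, which removes the quotient by
    theta^2 before differentiating; the velocity v is a separate argument, so
    that its regularity can be assumed independently of that of x. *)
Definition lyapunov (R : realType) (H : normedModType R) (mu t0 : R)
    (theta : R -> R) (Phi : H -> R) (x v : R -> H) (xstar : H) (t : R) : R :=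
  expR (\int[lebesgue_measure]_(s in `[t0, t]) (mu * theta s)) *
  (theta t ^+ 2 * (Phi (x t) - Phi xstar) +
   2^-1 * `|x t - xstar + theta t *: v t| ^+ 2).

Lemma energy_lyapunov (R : realType) (H : normedModType R) (mu t0 : R)
    (theta : R -> R) (Phi : H -> R) (x : R -> H) (xstar : H) (t : R) :
  theta t != 0 ->
  energy mu t0 theta Phi x xstar t =
  lyapunov mu t0 theta Phi x (derive_on `[t0, +oo[ x) xstar t.
Proof. by move=> th0; rewrite /energy /lyapunov /scaling; field. Qed.

Lemma lyapunov_continuous (R : realType) (H : normedModType R) (mu a b : R)
    (theta : R -> R) (Phi : H -> R) (x v : R -> H) (xstar : H) :
  a <= b -> continuous Phi ->
  {within `[a, b], continuous theta} -> {within `[a, b], continuous x} ->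
  {within `[a, b], continuous v} ->
  {within `[a, b], continuous (lyapunov mu a theta Phi x v xstar)}.
Proof.
move=> ab cPhi cth cx cv.
have cmu : {within `[a, b], continuous (fun s => mu * theta s)}.
  by move=> s; apply: cvgM; [exact: cvg_cst|exact: cth].
have cI := integral_continuous ab cmu.
move/subspace_continuousP in cth; move/subspace_continuousP in cx.
move/subspace_continuousP in cv; move/subspace_continuousP in cI.
apply/subspace_continuousP => s sab.
have {}cth := cth _ sab; have {}cx := cx _ sab.
have {}cv := cv _ sab; have {}cI := cI _ sab.
apply: cvgM; first by apply: continuous_cvg cI; exact: continuous_expR.
apply: cvgD.
  apply: cvgM.
    by rewrite expr2; under eq_fun do rewrite expr2; exact: cvgM.
  by apply: cvgB; [apply: continuous_cvg cx; exact: cPhi|exact: cvg_cst].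
apply: cvgM; first exact: cvg_cst.
rewrite expr2; under eq_fun do rewrite expr2.
have cz : x r - xstar + theta r *: v r @[r --> within `[a, b] (nbhs s)] -->
    x s - xstar + theta s *: v s.
  by apply: cvgD; [apply: cvgB => //; exact: cvg_cst|exact: cvgZ].
by apply: cvgM; exact: cvg_norm.
Qed.

Lemma is_derive_lyapunov (R : realType) (H : normedModType R)
    (dot : {dot H for idfun}) (hdot : norm_from_dot dot) (mu a b t : R)
    (theta : R -> R) (Phi : H -> R) (x v : R -> H) (xstar dv : H) (dth : R) :
  a < t < b -> {within `[a, b], continuous theta} ->
  differentiable Phi (x t) -> is_derive t 1 theta dth ->
  is_derive t 1 x (v t) -> is_derive t 1 v dv ->
  is_derive t 1 (lyapunov mu a theta Phi x v xstar)
    (expR (\int[lebesgue_measure]_(s in `[a, t]) (mu * theta s)) *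
     (mu * theta t * (theta t ^+ 2 * (Phi (x t) - Phi xstar) +
        2^-1 * `|x t - xstar + theta t *: v t| ^+ 2) +
      (2 * theta t * dth * (Phi (x t) - Phi xstar) +
       theta t ^+ 2 * 'd Phi (x t) (v t) +
       dot (x t - xstar + theta t *: v t)
         (v t + (dth *: v t + theta t *: dv))))).
Proof.
move=> atb cth dPhi dtheta dx dv'.
have cmu : {within `[a, b], continuous (fun s => mu * theta s)}.
  by move=> s; apply: cvgM; [exact: cvg_cst|exact: cth].
have dI := is_derive_integral atb cmu.
have dK := is_derive1_comp (is_derive_expR _) dI.
have dz : is_derive t 1 (fun s => x s - xstar + theta s *: v s)
    (v t + (dth *: v t + theta t *: dv)).
  have := is_deriveD (is_deriveB dx (is_derive_cst xstar t 1))
    (is_derive_scale dtheta dv').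
  by rewrite subr0.
have dP := is_deriveB (is_derive_comp_differential dPhi dx)
  (is_derive_cst (Phi xstar) t 1).
have dG := is_deriveD (is_deriveM (is_deriveX 2 dtheta) dP)
  (is_deriveZ 2^-1 (is_derive_normsq hdot dz)).
apply: (is_derive_eq (is_deriveM dK dG)).
rewrite /= !fctE /= subr0 -![_ *: (_ : R)]/(_ * _).
by field.
Qed.

(** * The convergence rate *)

Theorem theorem2p2 (R : realType) (H : completeNormedModType R)
    (dot : {dot H for idfun}) (hdot : norm_from_dot dot)
    (mu t0 : R) (mu_ge0 : 0 <= mu) (t0_gt0 : 0 < t0)
    (Phi : H -> R)
    (Phi_C1 : continuously_frechet_differentiable Phi)
    (Phi_convex : strongly_convex dot mu Phi)
    (argmin_neq0 : argmin Phi !=set0)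
    (theta : R -> R)
    (theta_gt0 : forall t, t0 <= t -> 0 < theta t)
    (theta_C1 : C1_on `[t0, +oo[ theta)
    (theta_nd : {in `[t0, +oo[ &, {homo theta : s t / s <= t}})
    (theta_bound : forall t, t0 <= t ->
       0 < 2 * derive_on `[t0, +oo[ theta t + mu * theta t ^+ 2 <= 1)
    (x : R -> H)
    (x_C2 : C2_on `[t0, +oo[ x)
    (x_sol : forall t, t0 <= t ->
       derive_on `[t0, +oo[ (derive_on `[t0, +oo[ x) t +
       ((1 + derive_on `[t0, +oo[ theta t) / theta t + mu * theta t) *:
         derive_on `[t0, +oo[ x t +
       gradient dot Phi (x t) = 0)
    (xstar : H) (xstar_argmin : argmin Phi xstar)
    (t : R) (t0_le_t : t0 <= t) :
  Phi (x t) - Phi xstar <=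
    energy mu t0 theta Phi x xstar t0 / scaling mu t0 theta t.
Proof.
have [Phid _] := Phi_C1.
have [xd [vd _]] := x_C2; have [thd _] := theta_C1.
set D : set R := `[t0, +oo[%classic in xd vd thd theta_bound x_sol *.
set v := derive_on D x in vd x_sol.
pose W := lyapunov mu t0 theta Phi x v xstar.
have subD : `[t0, t] `<=` D by exact: subset_itvl.
have wc (V : normedModType R) (f : R -> V) :
    derivable_on D f -> {within `[t0, t], continuous f}.
  move=> fd; apply: continuous_subspaceW subD _.
  exact: derivable_on_continuous.
have cW : {within `[t0, t], continuous W}.
  apply: lyapunov_continuous => //; [|exact: wc..].
  by move=> u; exact: differentiable_continuous.
have dW s : s \in `]t0, t[ -> exists2 d, is_derive s 1 W d & d <= 0.
  rewrite in_itv /= => sT; have /andP[t0s _] := sT.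
  have Ds : nbhs s D.
    apply: filterS (lt_nbhsr t0s) => r t0r.
    by rewrite /D /= in_itv /= andbT ltW.
  have dWs := is_derive_lyapunov hdot mu xstar sT (wc _ _ thd) (Phid (x s))
    (is_derive_derive_on Ds thd) (is_derive_derive_on Ds xd)
    (is_derive_derive_on Ds vd).
  eexists; first exact: dWs.
  have /andP[_ bnd] := theta_bound s (ltW t0s).
  rewrite pmulr_rle0 ?expR_gt0 //.
  rewrite (strongly_convex_gradient _ mu_ge0 Phi_convex) //.
  apply: (inertial_dissipation hdot mu_ge0 _ bnd).
  - exact/theta_gt0/ltW.
  - by rewrite subr_ge0.
  - have := Phi_convex (x s) xstar.
    rewrite -opprB normrN -scaleN1r dotZr; lra.
  - exact/x_sol/ltW.
have Wle : W t <= W t0.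
  apply: (ler0_derive1_le_cc _ _ cW) => //.
  - by move=> s /dW[d [? _] _].
  - by move=> s /dW[d [_ dE] d0]; rewrite derive1E dE.
  - by rewrite in_itv /= t0_le_t lexx.
  - by rewrite in_itv /= lexx.
have tht := theta_gt0 t t0_le_t.
have A0 : 0 < scaling mu t0 theta t by rewrite mulr_gt0 ?exprn_gt0 ?expR_gt0.
rewrite ler_pdivlMr // energy_lyapunov ?gt_eqF ?theta_gt0 //.
apply: le_trans Wle; rewrite /W /lyapunov /scaling mulrDr.
rewrite [leLHS](_ : _ = expR (\int[lebesgue_measure]_(s in `[t0, t])
  (mu * theta s)) * (theta t ^+ 2 * (Phi (x t) - Phi xstar))); last by ring.
by rewrite lerDl mulr_ge0 ?expR_ge0 // mulr_ge0 ?invr_ge0 // sqr_ge0.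
Qed.
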